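(* Let $0<r<1$ and let $\underline{T}=(T_1,\dots,T_d)$ be a tuple of invertible operators on a Hilbert space $\mathcal H$. Then $\underline{T}$ is a doubly commuting tuple of operators in $QA_r$ if and only if there exist a tuple $(U_1,\dots,U_d)$ of commuting unitaries and a tuple $(D_1,\dots,D_d)$ of commuting self-adjoint operators on $\mathcal H$ such that $\sigma(D_j)\subseteq\overline{A_r}$ for each $j$, $D_iU_j=U_jD_i$ for $1\le i,j\le d$ with $i\ne j$, and $T_j=U_jD_j$ for $1\le j\le d$.
   Context: $QA_r=\{T: T\text{ invertible},\ \|rT\|\le1,\ \|rT^{-1}\|\le1\}$. $A_r=\{z\in\mathbb C: r<|z|<r^{-1}\}$ and $\overline{A_r}$ is its closure. A tuple is doubly commuting if $T_iT_j=T_jT_i$ for all $i,j$ and $T_iT_j^*=T_j^*T_i$ for $i\ne j$. *)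

(* Defs.v *)
(* MathComp + mathcomp-real-closed complex numbers R[i]. *)
From mathcomp Require Import all_boot all_order all_algebra.
From mathcomp Require Import reals complex.
Set Implicit Arguments. Unset Strict Implicit. Unset Printing Implicit Defensive.
Import Order.TTheory GRing.Theory Num.Theory.
Local Open Scope ring_scope.
Local Open Scope complex_scope.

Section Hilbert.
Variables (R : realType) (V : lmodType R[i]) (ip : V -> V -> R[i]).

(* complex inner product, linear in the first argument *)
Definition is_inner_product : Prop :=
  [/\ (forall (a : R[i]) x y z, ip (a *: x + y) z = a * ip x z + ip y z),
      (forall x y, ip y x = (ip x y)^*),
      (forall x, 0 <= ip x x) &
      (forall x, ip x x = 0 -> x = 0)].

(* the induced norm ||x|| = sqrt <x,x> *)
Definition hnorm (x : V) : R := Num.sqrt (complex.Re (ip x x)).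

Definition complete_ip : Prop :=
  forall u : nat -> V,
    (forall e : R, 0 < e -> exists N, forall m n, (N <= m)%N -> (N <= n)%N ->
        hnorm (u m - u n) < e) ->
    exists l : V, forall e : R, 0 < e -> exists N, forall n, (N <= n)%N ->
        hnorm (u n - l) < e.

(* (V, ip) is a complex Hilbert space *)
Definition hilbert : Prop := is_inner_product /\ complete_ip.

(* bounded linear operator on V *)
Definition bounded_op (T : V -> V) : Prop :=
  (forall (a : R[i]) x y, T (a *: x + y) = a *: T x + T y) /\
  exists M : R, forall x, hnorm (T x) <= M * hnorm x.

(* invertible in B(H): bounded with a bounded two-sided inverse *)
Definition invertible_op (T : V -> V) : Prop :=
  bounded_op T /\ exists S, [/\ bounded_op S, cancel T S & cancel S T].

(* S is the adjoint of T *)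
Definition adjoint_of (T S : V -> V) : Prop :=
  forall x y, ip (T x) y = ip x (S y).

Definition selfadjoint (T : V -> V) : Prop := bounded_op T /\ adjoint_of T T.

(* U^* U = U U^* = I *)
Definition unitary (U : V -> V) : Prop :=
  bounded_op U /\ exists S, [/\ adjoint_of U S, cancel U S & cancel S U].

(* z belongs to the spectrum of T : T - z I is not invertible in B(H) *)
Definition spectrum (T : V -> V) (z : R[i]) : Prop :=
  ~ invertible_op (fun x => T x - z *: x).

(* T in QA_r : T invertible, ||r T|| <= 1, ||r T^{-1}|| <= 1 *)
Definition in_QA (r : R) (T : V -> V) : Prop :=
  [/\ invertible_op T,
      (forall x, r * hnorm (T x) <= hnorm x) &
      (forall S, cancel T S -> cancel S T -> forall x, r * hnorm (S x) <= hnorm x)].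

Definition commuting_tuple (d : nat) (T : 'I_d -> V -> V) : Prop :=
  forall i j, T i \o T j =1 T j \o T i.

Definition doubly_commuting (d : nat) (T : 'I_d -> V -> V) : Prop :=
  commuting_tuple T /\
  forall i j, i != j -> forall S, adjoint_of (T j) S -> T i \o S =1 S \o T i.

End Hilbert.

(* closed annulus  r <= |z| <= 1/r *)
Definition closed_annulus (R : realType) (r : R) (z : R[i]) : Prop :=
  (r%:C <= `|z|) /\ (`|z| <= (r^-1)%:C).

(* Main.v *)
(* If T is a doubly commuting tuple in QA_r, take D_j = |T_j| and U_j = T_j |T_j|^-1.
   Since |T_j| commutes with everything that commutes with T_j^* T_j, all the required
   commutation relations pass from the T_j, T_j^* to the U_j, D_j, and
   r |x| <= |D_j x| <= |x| / r puts the spectrum of D_j in the annulus by a Neumann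
   series argument.  As T_j^* T_j is bounded below, its square root is obtained from a
   norm contraction.  Conversely, the relations on U, D give double commutation at once,
   |T_j x| = |D_j x|, and the norm bounds for D_j and D_j^-1 hold because plus or minus
   the norm of a self-adjoint operator belongs to its spectrum. *)
Require Import Defs.
From mathcomp Require Import all_boot all_order all_algebra.
From mathcomp Require Import boolp classical_sets reals complex ring lra.
Set Implicit Arguments. Unset Strict Implicit. Unset Printing Implicit Defensive.
Import Order.TTheory GRing.Theory Num.Theory.
Local Open Scope ring_scope.
Local Open Scope complex_scope.

(** * Geometric sequences of real numbers *)

Section Geometric.
Variable R : realType.
Implicit Types a b c q e : R.

Lemma bernoulli c n : 0 <= c -> 1 + n%:R * c <= (1 + c) ^+ n.
Proof.
move=> c0; elim: n => [|n IHn]; first by rewrite expr0 mul0r addr0.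
rewrite exprS -natr1; have n0 : 0 <= n%:R :> R by [].
have : 0 <= (n%:R * c) * c by rewrite !mulr_ge0.
by nra.
Qed.

Lemma geometric_lt c q e : 0 <= q -> q < 1 -> 0 <= c -> 0 < e ->
  exists N, forall n, (N <= n)%N -> c * q ^+ n < e.
Proof.
move=> q0 q1 c0 e0.
suff [N hN] : exists N, c * q ^+ N < e.
  exists N => n leNn; apply: le_lt_trans hN; apply: ler_wpM2l => //.
  by apply: ler_wiXn2l leNn => //; exact: ltW.
have [q00|qn0] := eqVneq q 0; first by exists 1%N; rewrite q00 expr1 mulr0.
(* With [q^-1 = 1 + b], Bernoulli gives [q^-N >= 1 + N b], so any [N] above [c / (e b)] works. *)
have qp : 0 < q by rewrite lt_neqAle eq_sym qn0.
pose b := q^-1 - 1; have b0 : 0 < b by rewrite subr_gt0 invf_gt1.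
exists (Num.bound (c / e / b)); set N := Num.bound _.
have hN : c / e / b < N%:R by apply: archi_boundP; rewrite !divr_ge0 // ltW.
have := bernoulli N (ltW b0); rewrite [1 + b]addrC subrK exprVn => hb.
rewrite -ltr_pdivlMr ?exprn_gt0 // mulrC -ltr_pdivrMr //.
apply: lt_le_trans hb; rewrite ltr_pdivrMr // in hN.
by apply: lt_le_trans hN _; rewrite lerDr ler01.
Qed.

(** This is how limits are taken throughout: a relation satisfied by a limit is obtained by bounding
    its defect by [c q^n] for every [n]. *)
Lemma le_geometric a c q :
  0 <= q -> q < 1 -> 0 <= c -> (forall n, a <= c * q ^+ n) -> a <= 0.
Proof.
move=> q0 q1 c0 h; rewrite leNgt; apply/negP => a0.
have [N hN] := geometric_lt q0 q1 c0 a0.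
by have := hN _ (leqnn N); rewrite ltNge h.
Qed.

End Geometric.

Section HilbertSpace.
Variables (R : realType) (V : lmodType R[i]) (ip : V -> V -> R[i]).
Hypothesis hH : hilbert ip.
Implicit Types (x y : V) (T S X : V -> V).

Local Notation nrm := (hnorm ip).
(* The real inner product underlying [ip]; it defines the same norm. *)
Let rip x y : R := complex.Re (ip x y).

(** * Linear maps *)

Definition lin T := forall (a : R[i]) x y, T (a *: x + y) = a *: T x + T y.

Section LinearMap.
Variables (T : V -> V) (hT : lin T).

Lemma linD x y : T (x + y) = T x + T y.
Proof. by have := hT 1 x y; rewrite !scale1r. Qed.

Lemma lin0 : T 0 = 0.
Proof. by apply: (addrI (T 0)); rewrite -linD !addr0. Qed.

Lemma linZ a x : T (a *: x) = a *: T x.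
Proof. by have := hT a x 0; rewrite !addr0 lin0 addr0. Qed.

Lemma linN x : T (- x) = - T x.
Proof. by rewrite -scaleN1r linZ scaleN1r. Qed.

Lemma linB x y : T (x - y) = T x - T y.
Proof. by rewrite linD linN. Qed.

Lemma lin_cancel S : cancel T S -> cancel S T -> lin S.
Proof. by move=> TS ST a x y; apply: (can_inj TS); rewrite hT !ST. Qed.

End LinearMap.

Lemma lin_comp T S : lin T -> lin S -> lin (T \o S).
Proof. by move=> hT hS a x y; rewrite /= hS hT. Qed.

(** * Algebra of the inner product and its norm, Cauchy-Schwarz, triangle inequality *)

Lemma ripDl x y z : rip (x + y) z = rip x z + rip y z.
Proof.
have [[h _ _ _] _] := hH; rewrite /rip.
by have := h 1 x y z; rewrite scale1r mul1r => ->; rewrite raddfD.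
Qed.

Lemma ripC x y : rip x y = rip y x.
Proof. by have [[_ h _ _] _] := hH; rewrite /rip h; case: (ip _ _). Qed.

Lemma ripDr x y z : rip z (x + y) = rip z x + rip z y.
Proof. by rewrite ripC ripDl !(ripC z). Qed.

Lemma ip0l z : ip 0 z = 0.
Proof.
have [[h _ _ _] _] := hH; have := h 1 0 0 z; rewrite scale1r addr0 mul1r => e.
by apply: (addrI (ip 0 z)); rewrite -e addr0.
Qed.

Lemma conjcR (a : R) : (a%:C)^*%R = a%:C.
Proof. by rewrite -[LHS]/(conjc _) /= oppr0. Qed.

Lemma ipZl a x y : ip (a *: x) y = a * ip x y.
Proof.
by have [[h _ _ _] _] := hH; have := h a x 0 y; rewrite addr0 ip0l addr0.
Qed.

Lemma ipZr a x y : ip x (a *: y) = a^* * ip x y.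
Proof.
have [[_ h _ _] _] := hH; rewrite h ipZl (h y x).
by case: a (ip y x) => ? ? [? ?] /=; simpc; congr (_ +i* _); ring.
Qed.

Lemma ripZl (a : R) x y : rip (a%:C *: x) y = a * rip x y.
Proof. by rewrite /rip ipZl; case: (ip x y) => u v /=; ring. Qed.

Lemma ripZr (a : R) x y : rip x (a%:C *: y) = a * rip x y.
Proof. by rewrite ripC ripZl ripC. Qed.

Lemma ripNl x y : rip (- x) y = - rip x y.
Proof.
by rewrite -scaleN1r -[-1](rmorphN1 (real_complex R)) ripZl mulN1r.
Qed.

Lemma ripNr x y : rip x (- y) = - rip x y.
Proof. by rewrite ripC ripNl ripC. Qed.

Lemma rip_ge0 x : 0 <= rip x x.
Proof.
have [[_ _ h _] _] := hH; have := h x; rewrite lecE => /andP[_].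
by [].
Qed.

Lemma rip_eq0 x : rip x x = 0 -> x = 0.
Proof.
have [[_ _ h0 h] _] := hH => e; apply: h; have := h0 x; rewrite lecE => /andP[/eqP i0 _].
by move: e i0; rewrite /rip; case: (ip x x) => u v /= -> ->.
Qed.

Definition ripE := (ripDl, ripDr, ripNl, ripNr, ripZl, ripZr).

Lemma nrm_sqr x : nrm x ^+ 2 = rip x x.
Proof. exact: (sqr_sqrtr (rip_ge0 x)). Qed.

Lemma nrm_ge0 x : 0 <= nrm x.
Proof. exact: sqrtr_ge0. Qed.
Hint Resolve nrm_ge0 : core.

Lemma nrm0_eq0 x : nrm x <= 0 -> x = 0.
Proof.
move=> h; apply: rip_eq0; rewrite -nrm_sqr.
by have /eqP -> : nrm x == 0 by [rewrite eq_le h nrm_ge0]; rewrite expr0n.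
Qed.

Lemma nrm_eq x y : rip x x = rip y y -> nrm x = nrm y.
Proof. by rewrite /hnorm -!/(rip _ _) => ->. Qed.

Lemma nrm0 : nrm 0 = 0.
Proof. by rewrite /hnorm ip0l sqrtr0. Qed.

Lemma nrmN x : nrm (- x) = nrm x.
Proof. by apply: nrm_eq; rewrite !ripE opprK. Qed.

Lemma nrmBC x y : nrm (x - y) = nrm (y - x).
Proof. by rewrite -nrmN opprB. Qed.

Lemma normcE (z : R[i]) : `|z| = (Normc.normc z)%:C.
Proof. by rewrite normc_def; case: z. Qed.

Lemma normc_ge0 (z : R[i]) : 0 <= Normc.normc z.
Proof. by rewrite -ler0c -normcE. Qed.

Lemma nrmZ a x : nrm (a *: x) = Normc.normc a * nrm x.
Proof.
apply/eqP; rewrite -(@eqrXn2 _ 2) ?mulr_ge0 ?nrm_ge0 ?normc_ge0 //.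
rewrite exprMn !nrm_sqr /rip ipZl ipZr; case: a => u v /=.
rewrite sqr_sqrtr ?addr_ge0 ?sqr_ge0 //; case: (ip x x) => s t /=; apply/eqP; ring.
Qed.

Lemma nrmZr (a : R) x : 0 <= a -> nrm (a%:C *: x) = a * nrm x.
Proof. by move=> a0; rewrite nrmZ /= expr0n addr0 sqrtr_sqr ger0_norm. Qed.

Lemma cauchy_schwarz x y : rip x y <= nrm x * nrm y.
Proof.
have [->|/eqP yn0] := eqVneq y 0.
  by rewrite ripC /rip ip0l nrm0 mulr0.
have yp : 0 < nrm y.
  by rewrite lt_neqAle nrm_ge0 andbT; apply/eqP => h; apply: yn0; apply: nrm0_eq0; rewrite -h.
(* The square of the norm of [|y| x - |x| y] expands to [2 |x| |y| (|x| |y| - rip x y)]; it remains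
   to cancel the positive factor. *)
have := rip_ge0 ((nrm y)%:C *: x - (nrm x)%:C *: y).
rewrite !ripE -!nrm_sqr (ripC y x) => h.
have [x0|xn0] := eqVneq (nrm x) 0.
  by rewrite x0 mul0r (@nrm0_eq0 x) ?x0 // /rip ip0l.
have xp : 0 < nrm x by rewrite lt_neqAle eq_sym xn0 nrm_ge0.
have p : 0 < nrm x * nrm y by rewrite mulr_gt0.
rewrite -(ler_pM2l p); nra.
Qed.

Lemma ler_nrmD x y : nrm (x + y) <= nrm x + nrm y.
Proof.
rewrite -(@ler_pXn2r _ 2) ?nnegrE ?addr_ge0 ?nrm_ge0 //.
rewrite nrm_sqr !ripE (ripC y x) -!nrm_sqr; have := cauchy_schwarz x y; nra.
Qed.

Lemma ler_nrmB x y z : nrm (x - z) <= nrm (x - y) + nrm (y - z).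
Proof. by rewrite -{1}(subrK y x) -addrA; exact: ler_nrmD. Qed.

(** Since [Re (i w) = - Im w], the imaginary part of [ip x y] is minus the real inner product of
    [i x] with [y]. *)
Lemma ip_eq_rip x y x' y' :
  (rip x y = rip x' y') -> (rip ('i%C *: x) y = rip ('i%C *: x') y') ->
  ip x y = ip x' y'.
Proof.
rewrite /rip !ipZl; case: (ip x y) (ip x' y') => a b [c d] /= -> h.
by congr (_ +i* _); move: h; rewrite !mul0r !mul1r !sub0r => /oppr_inj.
Qed.

Lemma rip_inj x y : (forall z, rip z x = rip z y) -> x = y.
Proof.
by move=> h; apply/subr0_eq/rip_eq0; rewrite ripDr ripNr h subrr.
Qed.

Lemma ip_inj x y : (forall z, ip z x = ip z y) -> x = y.
Proof. by move=> h; apply: rip_inj => z; rewrite /rip h. Qed.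

(** * Consequences of completeness: geometric convergence and the Riesz representation *)

Lemma geometric_cvg (u : nat -> V) (c q : R) : 0 <= q -> q < 1 -> 0 <= c ->
  (forall n, nrm (u n.+1 - u n) <= c * q ^+ n) ->
  exists l, forall n, nrm (u n - l) <= c / (1 - q) * q ^+ n.
Proof.
move=> q0 q1 c0 h; have q1' : 0 < 1 - q by rewrite subr_gt0.
pose k := c / (1 - q); have k0 : 0 <= k by rewrite divr_ge0 // ltW.
have kE : c = k * (1 - q) by rewrite /k mulfVK // gt_eqF.
(* As [c q^n = k q^n - k q^(n+1)], the increments telescope. *)
have hk n m : nrm (u (n + m)%N - u n) <= k * q ^+ n - k * q ^+ (n + m).
  elim: m => [|m IHm]; first by rewrite addn0 !subrr nrm0.
  apply: le_trans (ler_nrmB _ (u (n + m)%N) _) _; rewrite addnS.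
  apply: le_trans (lerD (h _) IHm) _; rewrite kE exprS; lra.
have hk' n m : (n <= m)%N -> nrm (u m - u n) <= k * q ^+ n.
  move=> /subnKC <-; apply: le_trans (hk _ _) _.
  by rewrite lerBlDr lerDl mulr_ge0 // exprn_ge0.
have [_ compl] := hH.
have [|l hl] := compl u.
  move=> e e0; have [N hN] := geometric_lt q0 q1 k0 e0; exists N => m n Nm Nn.
  have [mn|/ltnW nm] := leqP m n.
    by rewrite nrmBC; apply: le_lt_trans (hk' _ _ mn) (hN _ Nm).
  by apply: le_lt_trans (hk' _ _ nm) (hN _ Nn).
exists l => n; apply/ler_addgt0Pr => e e0; have [N hN] := hl e e0.
apply: le_trans (ler_nrmB _ (u (maxn N n)) _) _; apply: lerD.
  by rewrite nrmBC; apply: hk'; rewrite leq_maxr.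
by apply/ltW/hN; rewrite leq_maxl.
Qed.

Lemma geometric_eq x y (c q : R) : 0 <= q -> q < 1 -> 0 <= c ->
  (forall n, nrm (x - y) <= c * q ^+ n) -> x = y.
Proof. by move=> q0 q1 c0 h; apply/subr0_eq/nrm0_eq0/(le_geometric q0 q1 c0). Qed.

(* [y] minimises [J x = |x|^2 - 2 f x]: the parallelogram law makes a minimising
   sequence Cauchy. *)
Lemma riesz (f : V -> R) (M : R) :
  (forall x y, f (x + y) = f x + f y) -> (forall (a : R) x, f (a%:C *: x) = a * f x) ->
  (forall x, f x <= M * nrm x) -> exists y, forall x, f x = rip x y.
Proof.
move=> fD fZ fM.
pose J x := rip x x - 2 * f x.
have JM x : - M ^+ 2 <= J x.
  rewrite /J -nrm_sqr; have := fM x; have := sqr_ge0 (nrm x - M); nra.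
pose E : set R := fun t => exists x, t = J x.
have Elb : has_lbound E by exists (- M ^+ 2) => _ [x ->].
have Ei : has_inf E by split=> //; exists (J 0), 0.
have mE x : inf E <= J x by apply: ge_inf => //; exists x.
(* The excess [4^-n] is the square of [2^-n]: the identity [par] then puts consecutive terms within
   [2 * 2^-n] of each other. *)
have /choice[u hu] n : exists x, J x <= inf E + (4^-1) ^+ n.
  have q0 : 0 < (4^-1) ^+ n :> R by rewrite exprn_gt0 // invr_gt0.
  have [_ [x ->] h] := inf_adherent q0 Ei.
  by exists x; exact: ltW.
have par x y : nrm (x - y) ^+ 2 = 2 * J x + 2 * J y - 4 * J ((2^-1)%:C *: (x + y)).
  rewrite nrm_sqr /J !ripE fZ fD (ripC y x); lra.
have h0 : 0 <= 2^-1 :> R by lra.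
have h1 : 2^-1 < 1 :> R by lra.
have [|l hl] := @geometric_cvg u 2 (2^-1) h0 h1 (ler0n _ 2).
  move=> n; have q0 := exprn_ge0 n h0.
  rewrite -(@ler_pXn2r _ 2) ?nnegrE ?mulr_ge0 ?nrm_ge0 // par.
  have := hu n; have := hu n.+1; have := mE ((2^-1)%:C *: (u n.+1 + u n)).
  have q1 : (4^-1) ^+ n = ((2^-1) ^+ n) ^+ 2 :> R by rewrite exprAC; congr (_ ^+ _); field.
  by rewrite (exprS 4^-1) q1 exprMn; have := sqr_ge0 ((2^-1) ^+ n : R); lra.
exists l => x.
(* First-order condition at an approximate minimiser: move [u n] by [s q x] with [q = 2^-n], so that
   the excess and the second-order term are both of order [q^2], and divide by [q]. The signs
   [s = 1] and [s = -1] give the two inequalities. *)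
have key n (s : R) : s ^+ 2 = 1 ->
    s * (f x - rip x l) <= (4 * nrm x + (1 + nrm x ^+ 2) / 2) * (2^-1) ^+ n.
  move=> s1; set q := (2^-1) ^+ n; have q0 : 0 < q by rewrite exprn_gt0 //; lra.
  have := mE (u n + (s * q)%:C *: x); have := hu n.
  have -> : (4^-1) ^+ n = q ^+ 2 by rewrite exprAC; congr (_ ^+ _); field.
  rewrite /J fD fZ !ripE (ripC x (u n)) => h2 h3.
  have h4 : s * (f x - rip (u n) x) <= (1 + nrm x ^+ 2) / 2 * q.
    have sq : s * q * (s * q * nrm x ^+ 2) = q * q * nrm x ^+ 2.
      by transitivity (s ^+ 2 * (q * q * nrm x ^+ 2)); [ring | rewrite s1 mul1r].
    rewrite nrm_sqr in sq; rewrite nrm_sqr -(ler_pM2l q0); nra.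
  have h5 : s * rip (u n - l) x <= 4 * nrm x * q.
    rewrite -ripZl; apply: le_trans (cauchy_schwarz _ _) _.
    have -> : nrm (s%:C *: (u n - l)) = nrm (u n - l).
      apply: nrm_eq; rewrite ripZl ripZr mulrA -expr2 s1 mul1r //.
    have := hl n; rewrite -/q => h6; have := nrm_ge0 x; have : 2 / (1 - 2^-1) = 4 :> R by field.
    by move=> e; rewrite e in h6; nra.
  by move: h5; rewrite !ripE (ripC x l) => h5; nra.
have K0 : 0 <= 4 * nrm x + (1 + nrm x ^+ 2) / 2.
  by have := nrm_ge0 x; have := sqr_ge0 (nrm x); lra.
have := le_geometric h0 h1 K0 (fun n => key n 1 (expr1n _ 2)).
have := le_geometric h0 h1 K0 (fun n => key n (-1) (sqrr_sign _ 1)).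
lra.
Qed.

(** * Adjoints and bounded operators *)

Lemma ipDr x y z : ip z (x + y) = ip z x + ip z y.
Proof.
have [[h hc _ _] _] := hH; rewrite hc -{1}(scale1r x) h mul1r (hc x z) (hc y z).
by rewrite -rmorphD.
Qed.

Lemma ipDl x y z : ip (x + y) z = ip x z + ip y z.
Proof. by have [[h _ _ _] _] := hH; have := h 1 x y z; rewrite scale1r mul1r. Qed.

Lemma ipBl x y z : ip (x - y) z = ip x z - ip y z.
Proof. by rewrite ipDl -scaleN1r ipZl mulN1r. Qed.

Lemma ipBr x y z : ip z (x - y) = ip z x - ip z y.
Proof. by rewrite ipDr -scaleN1r ipZr rmorphN1 mulN1r. Qed.

Lemma adjoint_sym T S : adjoint_of ip T S -> adjoint_of ip S T.
Proof.
by move=> h x y; have [[_ hc _ _] _] := hH; rewrite hc -h -hc.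
Qed.

Lemma adjoint_unique T S S' : adjoint_of ip T S -> adjoint_of ip T S' -> S = S'.
Proof. by move=> h h'; apply: funext => y; apply: ip_inj => z; rewrite -h h'. Qed.

Lemma adjoint_comp T T' S S' : adjoint_of ip T S -> adjoint_of ip T' S' ->
  adjoint_of ip (T \o T') (S' \o S).
Proof. by move=> h h' x y; rewrite /= h h'. Qed.

Lemma adjoint_rip T S : adjoint_of ip T S -> forall x y, rip (T x) y = rip x (S y).
Proof. by move=> h x y; rewrite /rip h. Qed.

Lemma adjoint_lin T S : adjoint_of ip T S -> lin S.
Proof. by move=> h a x y; apply: ip_inj => z; rewrite -h !ipDr !ipZr !h. Qed.

Lemma adjoint_bound T S (M : R) : adjoint_of ip T S ->
  (forall x, nrm (T x) <= M * nrm x) -> forall x, nrm (S x) <= M * nrm x.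
Proof.
(* For [S x] nonzero, [|S x|^2 = rip (T (S x)) x <= M |S x| |x|] is divided by [|S x|]. The sign of
   [M] is not given, so when [S x = 0] the inequality [0 <= M |x|] is read off from [hM x]. *)
move=> h hM x; have [h0|h0] := ltP 0 (nrm (S x)); last first.
  have Sx0 : nrm (S x) = 0 by apply/eqP; rewrite eq_le h0 nrm_ge0.
  have := hM x; have := nrm_ge0 (T x); rewrite Sx0; lra.
rewrite -(ler_pM2l h0) -expr2 nrm_sqr -(adjoint_rip h).
apply: le_trans (cauchy_schwarz _ _) _; rewrite mulrA [_ * M]mulrC.
by apply: ler_wpM2r => //; exact: hM.
Qed.

Lemma bounded_op_bound T : bounded_op ip T ->
  exists2 M, 0 <= M & forall x, nrm (T x) <= M * nrm x.
Proof.
move=> [_ [M hM]]; exists (Num.max 0 M); first by rewrite le_max lexx.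
move=> x; apply: le_trans (hM x) _; apply: ler_wpM2r => //.
by rewrite le_max lexx orbT.
Qed.

Lemma bounded_op_comp T S : bounded_op ip T -> bounded_op ip S -> bounded_op ip (T \o S).
Proof.
move=> bT bS; split; first by apply: lin_comp; [case: bT | case: bS].
have [M M0 hM] := bounded_op_bound bT; have [N _ hN] := bounded_op_bound bS.
exists (M * N) => x; apply: le_trans (hM _) _; rewrite -mulrA.
exact: ler_wpM2l.
Qed.

Lemma adjoint_bounded T S : bounded_op ip T -> adjoint_of ip T S -> bounded_op ip S.
Proof.
move=> [_ [M hM]] h; split; first exact: adjoint_lin h.
by exists M; exact: adjoint_bound h hM.
Qed.

(** Riesz represents only the real functional [x |-> rip (T x) y]; complex linearity of [T] lets the
    same vector be tested on [i x], which recovers the imaginary part. *)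
Lemma adjoint_exists T : bounded_op ip T -> exists S, adjoint_of ip T S.
Proof.
move=> bT; have [M M0 hM] := bounded_op_bound bT; have [lT _] := bT.
have /choice[S hS] y : exists s, forall x, rip (T x) y = rip x s.
  apply: (@riesz (fun x => rip (T x) y) (M * nrm y)) => [x z|a x|x].
  - by rewrite (linD lT) ripDl.
  - by rewrite (linZ lT) ripZl.
  - apply: le_trans (cauchy_schwarz _ _) _; rewrite mulrAC.
    exact: ler_wpM2r.
exists S => x y; apply: ip_eq_rip; first exact: hS.
by rewrite -(linZ lT) hS.
Qed.

(** * Invertible operators and the Neumann series *)

Lemma invertible_intro T (C : R) : bounded_op ip T ->
  (forall x, nrm x <= C * nrm (T x)) -> (forall y, exists x, T x = y) ->
  invertible_op ip T.
Proof.
move=> bT hC /choice[S TS]; have [lT _] := bT.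
have ST : cancel T S.
  move=> x; apply/subr0_eq/nrm0_eq0; apply: le_trans (hC _) _.
  by rewrite (linB lT) TS subrr nrm0 mulr0.
split=> //; exists S; split=> //; split; first exact: (lin_cancel lT).
by exists C => x; rewrite -{2}(TS x).
Qed.

Lemma invertible_comp T S : invertible_op ip T -> invertible_op ip S ->
  invertible_op ip (T \o S).
Proof.
move=> [bT [T' [bT' TT' T'T]]] [bS [S' [bS' SS' S'S]]].
split; first exact: bounded_op_comp.
exists (S' \o T'); split; first exact: bounded_op_comp.
- by move=> x /=; rewrite TT' SS'.
- by move=> x /=; rewrite S'S T'T.
Qed.

Lemma invertible_scale (a : R[i]) : a != 0 -> invertible_op ip (fun x => a *: x).
Proof.
have b c : bounded_op ip (fun x => c *: x).
  split; last by exists (Normc.normc c) => x; rewrite nrmZ.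
  by move=> d x y; rewrite scalerDr !scalerA mulrC.
move=> a0; split=> //; exists (fun x => a^-1 *: x); split=> // x.
  by rewrite scalerA mulVf // scale1r.
by rewrite scalerA mulfV // scale1r.
Qed.

(** With [S = T^-1], one has [T - K = (1 - K S) T], and the bound on [K] relative to [T] says that
    [K S] has norm at most [q < 1]. *)
Lemma invertible_perturb T K (q : R) : invertible_op ip T -> lin K -> 0 <= q -> q < 1 ->
  (forall x, nrm (K x) <= q * nrm (T x)) -> invertible_op ip (fun x => T x - K x).
Proof.
move=> [bT [S [bS TS ST]]] lK q0 q1 hK; have [lT _] := bT; have [lS _] := bS.
have q1' : 0 < 1 - q by rewrite subr_gt0.
have [M M0 hM] := bounded_op_bound bT; have [N N0 hN] := bounded_op_bound bS.
apply: (@invertible_intro _ (N / (1 - q))).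
- split.
    by move=> a x y; rewrite lT lK scalerBr opprD addrACA.
  exists ((1 + q) * M) => x; apply: le_trans (ler_nrmD _ _) _; rewrite nrmN.
  by have := hK x; have := hM x; nra.
- move=> x; have h1 : nrm (T x) <= nrm (T x - K x) + nrm (K x).
    by rewrite -{1}(subrK (K x) (T x)); exact: ler_nrmD.
  have h2 := hN (T x); rewrite TS in h2; apply: le_trans h2 _; rewrite -mulrA.
  apply: ler_wpM2l => //; rewrite mulrC ler_pdivlMr //; have := hK x; lra.
- move=> y; have hKS z : nrm (K (S z)) <= q * nrm z by rewrite -{2}(ST z).
  (* Partial sums of the Neumann series of [(1 - K S)^-1 y]. The limit [w] satisfies
     [w = y + K (S w)], so [S w] is the preimage of [y]. *)
  pose u n := iter n (fun w => y + K (S w)) 0.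
  have hu n : nrm (u n.+1 - u n) <= nrm y * q ^+ n.
    elim: n => [|n IHn].
      by rewrite /u /= (lin0 lS) (lin0 lK) addr0 subr0 expr0 mulr1.
    have -> : u n.+2 - u n.+1 = K (S (u n.+1 - u n)).
      by rewrite (linB lS) (linB lK) /u /= opprD addrACA subrr add0r.
    apply: le_trans (hKS _) _; rewrite exprS mulrCA; exact: ler_wpM2l.
  have [w hw] := geometric_cvg q0 q1 (nrm_ge0 y) hu.
  exists (S w); rewrite ST; apply/eqP; rewrite subr_eq; apply/eqP.
  set c := nrm y / (1 - q) in hw; have c0 : 0 <= c by rewrite divr_ge0 // ltW.
  apply: (@geometric_eq _ _ (2 * c) q) => // [|n]; first by rewrite mulr_ge0.
  apply: le_trans (ler_nrmB _ (u n.+1) _) _; rewrite nrmBC.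
  have -> : u n.+1 - (y + K (S w)) = K (S (u n - w)).
    by rewrite (linB lS) (linB lK) /u /= opprD addrACA subrr add0r.
  have := hKS (u n - w); have := hw n; have := hw n.+1; rewrite exprS.
  by have := mulr_ge0 c0 (exprn_ge0 n q0); nra.
Qed.

(** For [|z| < r], [D - z] is a perturbation of [D] by [z] with ratio [|z| / r]; for [|z| > 1/r] it
    is a perturbation of [-z] by [-D] with ratio [1 / (r |z|)]. *)
Lemma spectrum_annulus D (r : R) : 0 < r -> invertible_op ip D ->
  (forall x, r * nrm x <= nrm (D x)) -> (forall x, r * nrm (D x) <= nrm x) ->
  forall z : R[i], spectrum ip D z -> closed_annulus r z.
Proof.
move=> r0 iD lo hi z; have [[lD _] _] := iD.
rewrite /spectrum /closed_annulus normcE !lecR => sz.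
split; rewrite leNgt; apply/negP => hz; apply: sz.
- apply: (@invertible_perturb _ _ (Normc.normc z / r)) => //.
  + by move=> a x y; rewrite scalerDr !scalerA mulrC.
  + by rewrite divr_ge0 ?normc_ge0 ?ltW.
  + by rewrite ltr_pdivrMr // mul1r.
  + move=> x; rewrite nrmZ -mulrA; apply: ler_wpM2l; first exact: normc_ge0.
    by rewrite ler_pdivlMl.
- have z0 : 0 < Normc.normc z by apply: lt_trans hz; rewrite invr_gt0.
  have zn0 : - z != 0.
    by rewrite oppr_eq0 -normr_gt0 normcE ltcR.
  have -> : (fun x => D x - z *: x) = (fun x => (- z) *: x - (- D x)).
    by apply: funext => x; rewrite scaleNr opprK addrC.
  apply: (@invertible_perturb _ _ (r * Normc.normc z)^-1) => //.
  + exact: invertible_scale.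
  + by move=> a x y; rewrite lD opprD scalerN.
  + by rewrite invr_ge0 mulr_ge0 // ltW.
  + by rewrite invf_lt1 ?mulr_gt0 // -ltr_pdivrMl // mulr1.
  + move=> x; rewrite scaleNr !nrmN nrmZ ler_pdivlMl ?mulr_gt0 //.
    by rewrite mulrAC mulrC; apply: ler_wpM2l; [exact: ltW | exact: hi].
Qed.

(** * Operator norm and spectrum of self-adjoint operators *)

Lemma opnorm_exists T : bounded_op ip T -> exists M, [/\ 0 <= M,
  forall x, nrm (T x) <= M * nrm x &
  forall m, 0 <= m -> (forall x, nrm (T x) <= m * nrm x) -> M <= m].
Proof.
move=> bT; have [N N0 hN] := bounded_op_bound bT; have [lT _] := bT.
pose E : set R := fun m => 0 <= m /\ forall x, nrm (T x) <= m * nrm x.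
have Elb : has_lbound E by exists 0 => m [].
have EN : E N by [].
exists (inf E); split.
- by apply: lb_le_inf; [exists N | move=> m []].
- move=> x; have [x0|x0] := ltP 0 (nrm x); last first.
    by rewrite (nrm0_eq0 x0) (lin0 lT) nrm0 mulr0.
  rewrite -ler_pdivrMr //; apply: lb_le_inf; first by exists N.
  by move=> m [_ hm]; rewrite ler_pdivrMr.
- by move=> m m0 hm; apply: ge_inf.
Qed.

(* With [M] the norm of [D], one of [M], [-M] is in the spectrum: otherwise [D^2 - M^2]
   is bounded below, and [|D^2 x - M^2 x|^2 <= M^2 (M^2 |x|^2 - |D x|^2)] would
   improve the bound [M]. *)
Lemma selfadjoint_bound D (c : R) : selfadjoint ip D -> 0 <= c ->
  (forall z : R[i], spectrum ip D z -> `|z| <= c%:C) -> forall x, nrm (D x) <= c * nrm x.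
Proof.
move=> [bD aD] c0 hs; have [M [M0 hM Mmin]] := opnorm_exists bD; have [lD _] := bD.
suff Mc : M <= c.
  by move=> x; apply: le_trans (hM x) _; apply: ler_wpM2r.
rewrite leNgt; apply/negP => cM; have Mp : 0 < M by exact: le_lt_trans cM.
have inv (s : R) : s ^+ 2 = 1 -> invertible_op ip (fun x => D x - (s * M)%:C *: x).
  move=> s1; apply: contrapT => /hs; rewrite normcE lecR /= expr0n addr0 sqrtr_sqr.
  rewrite normrM (ger0_norm M0) -[`|s|]sqrtr_sqr s1 sqrtr1 mul1r.
  by rewrite leNgt cM.
(* [G] is a bounded inverse of [(D - M) (D + M) = D^2 - M^2]. *)
have [_ [G [bG GK KG]]] := invertible_comp (inv 1 (expr1n _ 2)) (inv (-1) (sqrr_sign _ 1)).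
have [K K0 hK] := bounded_op_bound bG.
have key x : nrm x ^+ 2 <= K ^+ 2 * (M ^+ 2 * (M ^+ 2 * nrm x ^+ 2 - nrm (D x) ^+ 2)).
  have := hK (D (D x) - (M ^+ 2)%:C *: x).
  have -> : G (D (D x) - (M ^+ 2)%:C *: x) = x.
    rewrite -[RHS]GK /=; congr (G _).
    rewrite mul1r mulN1r rmorphN scaleNr opprK (linD lD) (linZ lD).
    by rewrite scalerDr opprD addrA addrK rmorphXn scalerA expr2.
  rewrite -(@ler_pXn2r _ 2) ?nnegrE ?mulr_ge0 ?nrm_ge0 // exprMn => h.
  apply: le_trans h _; apply: ler_wpM2l; first exact: sqr_ge0.
  have e : rip (D (D x)) x = nrm (D x) ^+ 2 by rewrite (adjoint_rip aD) nrm_sqr.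
  rewrite [leLHS]nrm_sqr !ripE (ripC x) e -!nrm_sqr.
  by have := hM (D x); have := nrm_ge0 (D (D x)); have := nrm_ge0 (D x); nra.
(* The summand 1 keeps [k] positive even when [K = 0]; [key] then lowers the bound on [|D x|^2] from
   [M^2 |x|^2] by [|x|^2 / k]. *)
pose k := K ^+ 2 * M ^+ 2 + 1.
have kp : 0 < k by rewrite ltr_pwDr // mulr_ge0 // sqr_ge0.
have hD x : nrm (D x) ^+ 2 <= (M ^+ 2 - k^-1) * nrm x ^+ 2.
  rewrite mulrBl lerBrDr -lerBrDl ler_pdivrMl //.
  have : 0 <= M ^+ 2 * nrm x ^+ 2 - nrm (D x) ^+ 2.
    by rewrite subr_ge0 -exprMn ler_pXn2r ?nnegrE ?mulr_ge0 ?nrm_ge0.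
  by have := key x; rewrite /k; lra.
pose m := Num.sqrt (M ^+ 2 - k^-1).
have mM : m < M.
  rewrite -[M]ger0_norm // -sqrtr_sqr ltr_sqrt ?exprn_gt0 //.
  by rewrite ltrBlDr ltrDl invr_gt0.
suff : M <= m by rewrite leNgt mM.
apply: Mmin => [|x]; first exact: sqrtr_ge0.
rewrite -(@ler_pXn2r _ 2) ?nnegrE ?mulr_ge0 ?nrm_ge0 ?sqrtr_ge0 // exprMn.
(* [Num.sqrt] is 0 on negative reals, so [m^2 = M^2 - k^-1] needs the nonnegative case; otherwise
   [M^2 - k^-1 < 0 <= m^2] is enough. *)
have [h|h] := leP 0 (M ^+ 2 - k^-1); first by rewrite [m ^+ 2]sqr_sqrtr.
apply: le_trans (hD x) _; apply: ler_wpM2r; first exact: sqr_ge0.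
by apply: le_trans (ltW h) _; exact: sqr_ge0.
Qed.

(** * Square roots and the modulus of an operator *)

Lemma op_geometric_cvg (Y : nat -> V -> V) (c q : R) : 0 <= q -> q < 1 -> 0 <= c ->
  (forall n x, nrm (Y n.+1 x - Y n x) <= c * nrm x * q ^+ n) ->
  exists L, forall n x, nrm (Y n x - L x) <= c / (1 - q) * nrm x * q ^+ n.
Proof.
move=> q0 q1 c0 h.
have /choice[L hL] x : exists l, forall n, nrm (Y n x - l) <= c / (1 - q) * nrm x * q ^+ n.
  have cx0 : 0 <= c * nrm x by exact: mulr_ge0.
  have [l hl] := geometric_cvg q0 q1 cx0 (h ^~ x).
  by exists l => n; rewrite [_ / _ * _]mulrAC.
by exists L.
Qed.

(* [Y] is the fixed point of the contraction [Y |-> (B + Y^2) / 2], so that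
   [(1 - Y)^2 = 1 - B]; it inherits the commutant of [B] from the iterates. *)
Lemma sqrt_one_minus B (q : R) : selfadjoint ip B -> 0 <= q -> q < 1 ->
  (forall x, nrm (B x) <= q * nrm x) ->
  exists Y, [/\ selfadjoint ip Y,
    forall x, Y x + Y x = B x + Y (Y x) &
    forall X, bounded_op ip X -> X \o B =1 B \o X -> X \o Y =1 Y \o X].
Proof.
move=> [[lB _] aB] q0 q1 hB.
pose h : R[i] := (2^-1)%:C.
have hh z : h *: z + h *: z = z.
  have e : 2^-1 + 2^-1 = 1 :> R by field.
  by rewrite -scalerDl -rmorphD e scale1r.
have nh z : nrm (h *: z) = 2^-1 * nrm z by rewrite nrmZr // invr_ge0.
pose Y := fix Y n := if n is m.+1 then fun x => h *: (B x + Y m (Y m x)) else fun=> 0.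
have lY n : lin (Y n).
  elim: n => [|n IHn] a x y /=; first by rewrite scaler0 addr0.
  by rewrite !IHn lB addrACA -scalerDr [LHS]scalerDr !scalerA mulrC.
have aY n : adjoint_of ip (Y n) (Y n).
  elim: n => [|n IHn] x y /=; first by have [[_ hc _ _] _] := hH; rewrite (hc 0) !ip0l rmorph0.
  rewrite ipZl ipZr ipDr conjcR; congr (_ * _); rewrite -aB -!IHn.
  exact: ipDl.
have hY n x : nrm (Y n x) <= q * nrm x.
  elim: n x => [|n IHn] x /=; first by rewrite nrm0 mulr_ge0.
  rewrite nh; apply: le_trans (ler_wpM2l _ (ler_nrmD _ _)) _; first by rewrite invr_ge0.
  have := hB x; have := IHn x; have := IHn (Y n x); have := nrm_ge0 x.
  have := nrm_ge0 (Y n x); nra.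
have cY X n : lin X -> X \o B =1 B \o X -> X \o Y n =1 Y n \o X.
  move=> lX XB; elim: n => [|n IHn] x /=; first by rewrite (lin0 lX).
  have XBx : X (B x) = B (X x) := XB x; have XYx z : X (Y n z) = Y n (X z) := IHn z.
  by rewrite (linZ lX) (linD lX) XBx !XYx.
have dY n x : nrm (Y n.+1 x - Y n x) <= q * nrm x * q ^+ n.
  elim: n x => [|n IHn] x.
    rewrite /= subr0 addr0 nh expr0 mulr1.
    by have := hB x; have := nrm_ge0 (B x); lra.
  (* Writing [P] for [Y n.+1] and [Q] for [Y n], [P^2 - Q^2 = P (P - Q) + (P - Q) Q]. Both factors
     [P] and [Q] are bounded by [q], so the halved sum contracts the increment by [q]. *)
  have -> : Y n.+2 x - Y n.+1 x =
      h *: (Y n.+1 (Y n.+1 x - Y n x) + (Y n.+1 (Y n x) - Y n (Y n x))).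
    rewrite (linB (lY n.+1)) addrA subrK -[LHS]/(h *: _ - h *: _) -scalerBr.
    by rewrite opprD addrACA subrr add0r.
  rewrite nh; apply: le_trans (ler_wpM2l _ (ler_nrmD _ _)) _; first by rewrite invr_ge0.
  have h1 := IHn (Y n x); have h2 := hY n.+1 (Y n.+1 x - Y n x).
  have h3 := ler_wpM2l q0 (IHn x); have qn := exprn_ge0 n.+1 q0.
  have h4 := ler_wpM2r qn (hY n x).
  by rewrite exprS in qn h4 *; lra.
have [L hL] := op_geometric_cvg q0 q1 q0 dY.
set c := q / (1 - q) in hL; have c0 : 0 <= c by rewrite divr_ge0 // subr_ge0 ltW.
clearbody c.
have limL x z (k : R) : 0 <= k -> (forall n, nrm (Y n x - z) <= k * q ^+ n) -> L x = z.
  move=> k0 hk; apply: (@geometric_eq _ _ (c * nrm x + k) q) => // [|n].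
    by rewrite addr_ge0 // mulr_ge0.
  apply: le_trans (ler_nrmB _ (Y n x) _) _; rewrite nrmBC mulrDl.
  exact: lerD.
have aL : adjoint_of ip L L.
  move=> x y.
  have aux u v : rip (L u) v = rip u (L v).
    apply: le_anti; apply/andP; split; rewrite -subr_le0.
    - apply: (@le_geometric _ _ (2 * c * nrm u * nrm v) q) => // [|n]; first by rewrite !mulr_ge0.
      have -> : rip (L u) v - rip u (L v) = rip (L u - Y n u) v + rip u (Y n v - L v).
        by rewrite !ripE (adjoint_rip (aY n)); ring.
      apply: le_trans (lerD (cauchy_schwarz _ _) (cauchy_schwarz _ _)) _.
      rewrite nrmBC; have := ler_wpM2r (nrm_ge0 v) (hL n u).
      by have := ler_wpM2l (nrm_ge0 u) (hL n v); lra.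
    - apply: (@le_geometric _ _ (2 * c * nrm u * nrm v) q) => // [|n]; first by rewrite !mulr_ge0.
      have -> : rip u (L v) - rip (L u) v = rip (Y n u - L u) v + rip u (L v - Y n v).
        by rewrite !ripE (adjoint_rip (aY n)); ring.
      apply: le_trans (lerD (cauchy_schwarz _ _) (cauchy_schwarz _ _)) _.
      rewrite [nrm (L v - _)]nrmBC; have := ler_wpM2r (nrm_ge0 v) (hL n u).
      by have := ler_wpM2l (nrm_ge0 u) (hL n v); lra.
  apply: ip_eq_rip; first exact: aux.
  (* Linearity of [L] will only be deduced from self-adjointness, so [L (i x) = i L x] is obtained
     here by passing to the limit in the linear iterates. *)
  rewrite -aux; congr (rip _ _); apply/esym; apply: (limL _ _ (c * nrm x)).
    by rewrite mulr_ge0.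
  move=> n; rewrite (linZ (lY n)) -scalerBr nrmZ /= expr0n expr1n add0r sqrtr1 mul1r.
  exact: hL.
have hLq x : nrm (L x) <= q * nrm x.
  rewrite -subr_le0; apply: (@le_geometric _ _ (c * nrm x) q) => // [|n]; first by rewrite mulr_ge0.
  have := hL n x; have := hY n x; have := ler_nrmD (L x - Y n x) (Y n x).
  rewrite subrK nrmBC; lra.
exists L; split.
- by split=> //; split; [exact: adjoint_lin aL | exists q].
- move=> x; suff e : L x = h *: (B x + L (L x)) by rewrite {1 2}e hh.
  have lL := adjoint_lin aL.
  apply: (@geometric_eq _ _ (c * nrm x + c * nrm x) q) => // [|n].
    by rewrite addr_ge0 // mulr_ge0.
  apply: le_trans (ler_nrmB _ (Y n.+1 x) _) _; rewrite mulrDl; apply: lerD.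
    rewrite nrmBC; apply: le_trans (hL n.+1 x) _; apply: ler_wpM2l; first by rewrite mulr_ge0.
    by rewrite exprS ler_piMl ?exprn_ge0 // ltW.
  rewrite -[X in nrm X]/(h *: _ - h *: _) -scalerBr opprD addrACA subrr add0r nh.
  have -> : Y n (Y n x) - L (L x) = Y n (Y n x - L x) + (Y n (L x) - L (L x)).
    by rewrite (linB (lY n)) addrA subrK.
  apply: le_trans (ler_wpM2l _ (ler_nrmD _ _)) _; first by rewrite invr_ge0.
  have qn := exprn_ge0 n q0.
  have h1 := hL n x; have h2 := hY n (Y n x - L x); have h3 := hL n (L x).
  have h4 := ler_wpM2r qn (ler_wpM2l c0 (hLq x)).
  have h5 : q * nrm (Y n x - L x) <= nrm (Y n x - L x) by rewrite ler_piMl // ltW.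
  have h6 : c * (q * nrm x) * q ^+ n <= c * nrm x * q ^+ n.
    by apply: ler_wpM2r => //; apply: ler_wpM2l => //; rewrite ler_piMl // ltW.
  lra.
- move=> X bX XB x; have [lX _] := bX; have [M M0 hM] := bounded_op_bound bX.
  rewrite /=; apply/esym; apply: (limL _ _ (M * (c * nrm x))); first by rewrite !mulr_ge0.
  move=> n; have := cY X n lX XB x => /= <-; rewrite -(linB lX).
  by apply: le_trans (hM _) _; rewrite -mulrA; apply: ler_wpM2l.
Qed.

(* [B = 1 - r^2 T^* T] is a strict contraction, and [D = r^-1 sqrt (1 - B)]. *)
Lemma modulus_exists T S (r : R) : bounded_op ip T -> adjoint_of ip T S ->
  0 < r -> r < 1 ->
  (forall x, r * nrm (T x) <= nrm x) -> (forall x, r * nrm x <= nrm (T x)) ->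
  exists D, [/\ selfadjoint ip D, D \o D =1 S \o T &
    forall X, bounded_op ip X -> X \o (S \o T) =1 (S \o T) \o X -> X \o D =1 D \o X].
Proof.
move=> bT aT r0 r1 hi lo; have bS := adjoint_bounded bT aT.
have [lT _] := bT; have [lS _] := bS.
(* The value of [q] comes from [|B x|^2 = |x|^2 - 2 r^2 |T x|^2 + r^4 |S (T x)|^2]. The upper bound
   on [S] reduces this to at most [|x|^2 - r^2 |T x|^2], and the lower bound on [T] to at most
   [(1 - r^4) |x|^2]. *)
pose B x := x - (r ^+ 2)%:C *: S (T x); pose q := Num.sqrt (1 - r ^+ 4).
have r4 : r ^+ 4 <= 1 by rewrite exprn_ile1 // ltW.
have q2 : q ^+ 2 = 1 - r ^+ 4 by rewrite sqr_sqrtr // subr_ge0.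
have q1 : q < 1.
  by rewrite -[ltRHS]sqrtr1 ltr_sqrt ?ltr01 // ltrBlDr ltrDl exprn_gt0.
have hS x : nrm (S x) <= r^-1 * nrm x.
  by apply: (adjoint_bound aT) => y; rewrite ler_pdivlMl.
have hB x : nrm (B x) <= q * nrm x.
  rewrite -(@ler_pXn2r _ 2) ?nnegrE ?mulr_ge0 ?nrm_ge0 ?sqrtr_ge0 // exprMn q2.
  have e : rip (S (T x)) x = nrm (T x) ^+ 2 by rewrite ripC -(adjoint_rip aT) nrm_sqr.
  rewrite [leLHS]nrm_sqr /B !ripE (ripC x) e -!nrm_sqr.
  have h1 : r ^+ 2 * nrm (S (T x)) ^+ 2 <= nrm (T x) ^+ 2.
    rewrite -exprMn ler_pXn2r ?nnegrE ?mulr_ge0 ?nrm_ge0 ?(ltW r0) //.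
    by rewrite -ler_pdivlMl.
  have h2 : r ^+ 2 * nrm x ^+ 2 <= nrm (T x) ^+ 2.
    by rewrite -exprMn ler_pXn2r ?nnegrE ?mulr_ge0 ?nrm_ge0 ?(ltW r0).
  have r2 := sqr_ge0 r; have := ler_wpM2l r2 h1; have := ler_wpM2l r2 h2.
  by rewrite (_ : r ^+ 4 = r ^+ 2 * r ^+ 2) -?exprD //; lra.
have aB : adjoint_of ip B B.
  move=> x y; rewrite /B ipBl ipBr ipZl ipZr conjcR; congr (_ - _ * _).
  exact: (adjoint_comp (adjoint_sym aT) aT).
have bB : bounded_op ip B by split; [exact: adjoint_lin aB | exists q].
have [Y [[bY aY] eY cY]] := sqrt_one_minus (conj bB aB) (sqrtr_ge0 _) q1 hB.
have [lY _] := bY; have [M M0 hM] := bounded_op_bound bY.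
pose D x := (r^-1)%:C *: (x - Y x).
have aD : adjoint_of ip D D.
  by move=> x y; rewrite /D ipZl ipZr conjcR ipBl ipBr aY.
exists D; split.
- split=> //; split; first exact: adjoint_lin aD.
  have ri0 : 0 <= r^-1 by rewrite invr_ge0 ltW.
  exists (r^-1 * (1 + M)) => x; rewrite /D nrmZr // -mulrA; apply: ler_wpM2l => //.
  apply: le_trans (ler_nrmD _ _) _; rewrite nrmN mulrDl mul1r.
  by apply: lerD => //; exact: hM.
- move=> x; rewrite /= /D (linZ lY) (linB lY) -scalerBr scalerA.
  have -> : x - Y x - (Y x - Y (Y x)) = (r ^+ 2)%:C *: S (T x).
    have -> : x - Y x - (Y x - Y (Y x)) = x + Y (Y x) - (Y x + Y x).
      by rewrite opprB opprD [LHS]addrACA.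
    by rewrite eY opprD addrACA subrr addr0 /B opprB addrC subrK.
  rewrite scalerA -!rmorphM (_ : _ * _ = 1) ?scale1r //.
  by field; rewrite gt_eqF.
- move=> X bX cX x; have [lX _] := bX.
  have XB : X \o B =1 B \o X.
    by move=> z; rewrite /= /B (linB lX) (linZ lX); congr (_ - _ *: _); exact: cX.
  rewrite /= /D (linZ lX) (linB lX); congr (_ *: (_ - _)); exact: cY.
Qed.

(** * Inverses, adjoints and commutation relations *)

Lemma cancel_adjoint T S T' S' : adjoint_of ip T S -> adjoint_of ip T' S' ->
  cancel T' T -> cancel S S'.
Proof.
move=> aT aT' TT' y; apply: ip_inj => x.
by rewrite -[LHS]aT' -aT TT'.
Qed.

Lemma adjoint_invertible T S : invertible_op ip T -> adjoint_of ip T S ->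
  invertible_op ip S.
Proof.
move=> [bT [T' [bT' TT' T'T]]] aT; have [S' aT'] := adjoint_exists bT'.
split; first exact: adjoint_bounded bT aT.
exists S'; split; first exact: adjoint_bounded bT' aT'.
- exact: cancel_adjoint aT aT' T'T.
- exact: cancel_adjoint aT' aT TT'.
Qed.

(** If [G] inverts [D^2], then [G D] is a left inverse of [D], which bounds [D] below, and [D G] is
    a right inverse, which makes [D] surjective. *)
Lemma sqrt_invertible D : bounded_op ip D -> invertible_op ip (D \o D) ->
  invertible_op ip D.
Proof.
move=> bD [_ [G [bG DDG GDD]]].
have [M M0 hM] := bounded_op_bound (bounded_op_comp bG bD).
apply: (@invertible_intro _ M) => // [x|y].
  by rewrite -{1}(DDG x); exact: hM.
by exists (D (G y)); exact: GDD.
Qed.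

Lemma selfadjoint_inverse D E : adjoint_of ip D D -> cancel E D -> adjoint_of ip E E.
Proof. by move=> aD DE x y; rewrite -{1}(DE y) -aD DE. Qed.

Lemma cancel_adjoint_isometry U W : adjoint_of ip U W -> cancel U W ->
  forall x, nrm (U x) = nrm x.
Proof. by move=> aU UW x; apply: nrm_eq; rewrite (adjoint_rip aU) UW. Qed.

Definition comm (S T : V -> V) := S \o T =1 T \o S.

Lemma comm_sym S T : comm S T -> comm T S.
Proof. by move=> h x; rewrite h. Qed.

Lemma comm_compr X S T : comm X S -> comm X T -> comm X (S \o T).
Proof.
move=> hS hT x; have /= <- := congr1 S (hT x); exact: hS.
Qed.

Lemma comm_compl X S T : comm S X -> comm T X -> comm (S \o T) X.
Proof. by move=> hS hT; apply/comm_sym/comm_compr; exact: comm_sym. Qed.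

Lemma comm_invr X S T : comm X S -> cancel S T -> cancel T S -> comm X T.
Proof.
move=> h ST TS x; have /= e := h (T x).
by rewrite /= -[LHS]ST -e TS.
Qed.

Lemma comm_adjoint S T S' T' : adjoint_of ip S S' -> adjoint_of ip T T' ->
  comm S T -> comm S' T'.
Proof.
move=> aS aT h x; apply: ip_inj => z; rewrite /= -aS -aT -aT -aS.
by have /= <- := h z.
Qed.

(** * The polar decomposition of a tuple, in both directions *)

Section Polar.
Variables (r : R) (d : nat) (T : 'I_d -> V -> V).
Hypotheses (r0 : 0 < r) (r1 : r < 1) (iT : forall j, invertible_op ip (T j)).

Lemma polar_of_doubly_commuting :
  doubly_commuting ip T -> (forall j, in_QA ip r (T j)) ->
  exists U D : 'I_d -> V -> V,
    (forall j, unitary ip (U j)) /\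
    (forall j, selfadjoint ip (D j)) /\
    commuting_tuple U /\
    commuting_tuple D /\
    (forall j z, spectrum ip (D j) z -> closed_annulus r z) /\
    (forall i j, i != j -> D i \o U j =1 U j \o D i) /\
    (forall j, T j =1 U j \o D j).
Proof.
move=> [cT dT] qT; have bT j : bounded_op ip (T j) by case: (iT j).
have hi j x : r * nrm (T j x) <= nrm x by case: (qT j).
have lo j x : r * nrm x <= nrm (T j x).
  have [_ [T' [_ TT' T'T]]] := iT j; have [_ _ h] := qT j.
  by rewrite -{1}(TT' x); exact: h.
have /choice[S aT] j : exists S, adjoint_of ip (T j) S by exact: adjoint_exists.
have /choice[D hD] j := modulus_exists (bT j) (aT j) r0 r1 (hi j) (lo j).
have sD j : selfadjoint ip (D j) by case: (hD j).
have DD j x : D j (D j x) = S j (T j x) by case: (hD j) => _ h _; exact: h.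
have cD j X : bounded_op ip X -> comm X (S j \o T j) -> comm X (D j).
  by case: (hD j) => _ _; exact.
have iS j : invertible_op ip (S j) by exact: adjoint_invertible.
have iD j : invertible_op ip (D j).
  apply: sqrt_invertible; first by case: (sD j).
  by rewrite (funext (DD j : D j \o D j =1 S j \o T j)); exact: invertible_comp.
have /choice[E hE] j : exists E, [/\ bounded_op ip E, cancel (D j) E & cancel E (D j)].
  by case: (iD j) => _ h; exact: h.
have bE j : bounded_op ip (E j) by case: (hE j).
have DE j : cancel (D j) (E j) by case: (hE j).
have ED j : cancel (E j) (D j) by case: (hE j).
have nD j x : nrm (D j x) = nrm (T j x).
  have [_ aD] := sD j.
  by apply: nrm_eq; rewrite (adjoint_rip aD) DD -(adjoint_rip (aT j)).
(* For [i != j], double commutation makes [T j] and [S j] commute with [S i \o T i], hence with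
   [D i]. Then [D i] commutes with [S j \o T j], hence with [D j]. *)
have DT i j : i != j -> comm (D i) (T j).
  move=> ij; apply/comm_sym/cD => //; apply: comm_compr; last exact: cT.
  by apply: dT => //; rewrite eq_sym.
have DS i j : i != j -> comm (D i) (S j).
  move=> ij; apply/comm_sym/cD; first by case: (iS j).
  apply: comm_compr; first exact: comm_adjoint (aT j) (aT i) (cT j i).
  exact: comm_sym (dT i j ij _ (aT j)).
have DDc i j : comm (D i) (D j).
  have [->//|ij] := eqVneq i j; apply: cD; first by case: (sD i).
  by apply: comm_compr; [exact: DS | exact: DT].
have DEc i j : comm (D i) (E j) by exact: comm_invr (DDc i j) _ _.
have EEc i j : comm (E i) (E j).
  by apply: comm_sym; apply: comm_invr (DE i) (ED i); apply: comm_sym; exact: DEc.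
have TEc i j : i != j -> comm (T i) (E j).
  by move=> ij; apply: comm_invr (DE j) (ED j); apply/comm_sym/DT; rewrite eq_sym.
pose U j := T j \o E j.
exists U, D; split; [|split; [|split; [|split; [|split; [|split]]]]] => //.
- move=> j; split; first exact: bounded_op_comp.
  have [_ aD] := sD j; have aE := selfadjoint_inverse aD (ED j).
  exists (E j \o S j); split; first exact: adjoint_comp.
    by move=> x; rewrite /= -DD ED DE.
  (* Since [S j] is injective, it suffices to apply it to [T E E S y = y]; as [S T = D D], the left
     side becomes [D D E E S y = S y]. *)
  have [_ [S' [_ SS' _]]] := iS j.
  by move=> y; apply: (can_inj SS'); rewrite /= -DD !ED.
- move=> i j; have [->//|ij] := eqVneq i j; have ji : j != i by rewrite eq_sym.
  apply: comm_compl; apply: comm_compr; [exact: cT|exact: TEc| |exact: EEc].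
  by apply/comm_sym/TEc.
- move=> j; apply: spectrum_annulus => // x; rewrite nD; [exact: lo | exact: hi].
- by move=> i j ij; apply: comm_compr => //; exact: DT.
- by move=> j x; rewrite /U /= DE.
Qed.

(** The outer radius of the annulus bounds [D j], and the inner radius bounds its inverse, whose
    spectrum consists of reciprocals. The unitary factors preserve norms. *)
Lemma doubly_commuting_of_polar (U D : 'I_d -> V -> V) :
  (forall j, unitary ip (U j)) -> (forall j, selfadjoint ip (D j)) ->
  commuting_tuple U -> commuting_tuple D ->
  (forall j z, spectrum ip (D j) z -> closed_annulus r z) ->
  (forall i j, i != j -> D i \o U j =1 U j \o D i) ->
  (forall j, T j =1 U j \o D j) ->
  doubly_commuting ip T /\ forall j, in_QA ip r (T j).
Proof.
move=> uU sD cU cD hs cDU TE.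
have eT j : T j = U j \o D j by exact: funext.
have /choice[W hW] j : exists W, [/\ adjoint_of ip (U j) W, cancel (U j) W & cancel W (U j)].
  by case: (uU j).
have aU j : adjoint_of ip (U j) (W j) by case: (hW j).
have UW j : cancel (U j) (W j) by case: (hW j).
have WU j : cancel (W j) (U j) by case: (hW j).
have aD j : adjoint_of ip (D j) (D j) by case: (sD j).
have UWc i j : comm (U i) (W j) by exact: comm_invr (cU i j) _ _.
split.
  split=> [i j|i j ij S aS].
    have [->//|ij] := eqVneq i j; have ji : j != i by rewrite eq_sym.
    rewrite !eT; apply: comm_compl; apply: comm_compr;
      [exact: cU| |exact: cDU|exact: cD].
    by apply/comm_sym/cDU.
  have ji : j != i by rewrite eq_sym.
  (* By uniqueness of adjoints, the arbitrary adjoint [S] may be replaced by [D j \o W j]. *)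
  have aT : adjoint_of ip (T j) (D j \o W j) by rewrite eT; exact: adjoint_comp.
  rewrite (adjoint_unique aS aT) eT.
  apply: comm_compl; apply: comm_compr; [|exact: UWc|exact: cD|].
    by apply/comm_sym/cDU.
  by apply: comm_invr (UW j) (WU j); exact: cDU.
move=> j; have nU := cancel_adjoint_isometry (aU j) (UW j).
have nW := cancel_adjoint_isometry (adjoint_sym (aU j)) (WU j).
have ri0 : 0 <= r^-1 by rewrite invr_ge0 ltW.
split=> // [x|S TS ST x].
  rewrite eT /= nU -ler_pdivlMl //; apply: selfadjoint_bound => // z /hs[_].
  by [].
have iD : invertible_op ip (D j).
  have -> : D j = W j \o T j by apply: funext => z; rewrite eT /= UW.
  apply: invertible_comp (iT j); apply: adjoint_invertible (aU j).
  have [bU _] := uU j; split=> //; exists (W j); split=> //.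
  exact: adjoint_bounded bU (aU j).
have [_ [E [bE DE ED]]] := iD; have [lE _] := bE.
have -> : S x = E (W j x).
  by apply: (can_inj TS); rewrite ST eT /= ED WU.
rewrite -[leRHS]nW -ler_pdivlMl //; apply: selfadjoint_bound => //.
  by split=> //; exact: selfadjoint_inverse (aD j) ED.
(* For [z] nonzero, [E - z = (-z) E (D - z^-1)], so [z] in the spectrum of [E] forces [z^-1] into
   that of [D], where [r <= |z^-1|]. For [z = 0] the bound is trivial. *)
move=> z sz; have [->|z0] := eqVneq z 0; first by rewrite normr0 ler0c.
have : spectrum ip (D j) z^-1.
  move=> iDz; apply: sz.
  have -> : (fun y => E y - z *: y) =
      (fun y => (- z) *: y) \o (E \o (fun y => D j y - z^-1 *: y)).
    apply: funext => y; rewrite /= (linB lE) (linZ lE) DE scalerBr scalerA.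
    by rewrite mulNr mulfV // scaleNr scaleN1r opprK addrC.
  apply: invertible_comp; first by apply: invertible_scale; rewrite oppr_eq0.
  by apply: invertible_comp iDz; split=> //; exists (D j); split=> //; case: (sD j).
move=> /hs[h _]; rewrite normfV in h; move: h.
have zp : 0 < `|z| by rewrite normr_gt0.
move: zp; rewrite normcE ltcR => zp.
rewrite -[_^-1](fmorphV (real_complex R)) !lecR => h.
by rewrite -[leLHS]invrK lef_pV2 // posrE ?invr_gt0.
Qed.

End Polar.
End HilbertSpace.

Theorem theorem3p10 (R : realType) (V : lmodType R[i]) (ip : V -> V -> R[i])
  (hH : hilbert ip) (r : R) (hr0 : 0 < r) (hr1 : r < 1)
  (d : nat) (T : 'I_d -> V -> V) (hT : forall j, invertible_op ip (T j)) :
  (doubly_commuting ip T /\ forall j, in_QA ip r (T j)) <->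
  exists U D : 'I_d -> V -> V,
    (forall j, unitary ip (U j)) /\
    (forall j, selfadjoint ip (D j)) /\
    commuting_tuple U /\
    commuting_tuple D /\
    (forall j z, spectrum ip (D j) z -> closed_annulus r z) /\
    (forall i j, i != j -> D i \o U j =1 U j \o D i) /\
    (forall j, T j =1 U j \o D j).
Proof.
split=> [[dT qT]|[U [D [uU [sD [cU [cD [hs [cDU TE]]]]]]]]].
  exact: polar_of_doubly_commuting.
exact: doubly_commuting_of_polar uU sD cU cD hs cDU TE.
Qed.
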